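(* Let $S$ be a semigroup and let $\mathcal{F}$ be a filter on $S$ such that $\overline{\mathcal{F}}$ is a subsemigroup of $\beta S$. If $A\subseteq S$ is piecewise $\mathcal{F}$-syndetic, then there exist an $\mathcal{F}$-syndetic set $B\subseteq S$ and an $\mathcal{F}$-thick set $C\subseteq S$ such that $A=B\cap C$.
   Context: For a semigroup $S$, $A\subseteq S$ and $h\in S$, write $h^{-1}A=\{x\in S: hx\in A\}$. For a set $V$, $\mathcal{P}_f(V)$ is the set of nonempty finite subsets of $V$. A filter on $S$ is a nonempty family of subsets of $S$ that does not contain $\varnothing$, is closed under supersets (within $S$) and closed under pairwise intersections. An ultrafilter is a maximal filter (equivalently, a filter $\mathcal{F}$ such that $A\cup B\in\mathcal{F}$ implies $A\in\mathcal{F}$ or $B\in\mathcal{F}$). $\beta S$ is the set of all ultrafilters on $S$, with the semigroup operation $$p\cdot q=\{A\subseteq S: \{x\in S: x^{-1}A\in q\}\in p\}.$$ For a filter $\mathcal{F}$ on $S$, $\overline{\mathcal{F}}=\{p\in\beta S:\mathcal{F}\subseteq p\}$ and the mesh of $\mathcal{F}$ is $\mathcal{F}^*=\{A\subseteq S: S\setminus A\notin\mathcal{F}\}$. A set $A\subseteq S$ is: - $\mathcal{F}$-syndetic if for every $V\in\mathcal{F}$ there is $H\in\mathcal{P}_f(V)$ with $\bigcup_{h\in H}h^{-1}A\in\mathcal{F}$; - $\mathcal{F}$-thick if there is $V\in\mathcal{F}$ such that for all $H\in\mathcal{P}_f(V)$, $\bigcap_{h\in H}h^{-1}A\in\mathcal{F}^*$;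 - piecewise $\mathcal{F}$-syndetic if one can choose, for each $V\in\mathcal{F}$, some $H_V\in\mathcal{P}_f(V)$ and some $W_V\in\mathcal{F}$ such that the family $$\Big\{\Big(x^{-1}\bigcup_{h\in H_V}h^{-1}A\Big)\cap V:\ V\in\mathcal{F},\ x\in W_V\Big\}$$ has the finite intersection property (every finite subfamily has nonempty intersection). *)

(* Defs.v *)
From mathcomp Require Import all_boot all_order all_algebra finmap.
From mathcomp Require Import all_classical.

Set Implicit Arguments.
Unset Strict Implicit.
Unset Printing Implicit Defensive.

Local Open Scope classical_set_scope.

Section FilterSyndetic.
Variable S : semigroupType.
Implicit Types (A V : set S) (F p q : set_system S).

(* [h^-1 A]: a preimage, as [S] need not have inverses *)
Definition lpreim (h : S) A : set S := [set x | A (h * x)%g].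

Definition nonempty_finite_subsets V : set (set S) :=
  [set H | [/\ finite_set H, H !=set0 & H `<=` V]].

Definition beta : set (set_system S) := [set p | UltraFilter p].

Definition beta_mul p q : set_system S := [set A | p [set x | q (lpreim x A)]].

Definition beta_subsemigroup (T : set (set_system S)) : Prop :=
  T `<=` beta /\ (forall p q, T p -> T q -> T (beta_mul p q)).

Definition filter_closure F : set (set_system S) :=
  [set p | beta p /\ F `<=` p].

Definition mesh F : set_system S := [set A | ~ F (~` A)].

Definition syndetic F A : Prop :=
  forall V, F V ->
    exists2 H, nonempty_finite_subsets V H & F (\bigcup_(h in H) lpreim h A).

Definition thick F A : Prop :=
  exists2 V, F V &
    forall H, nonempty_finite_subsets V H ->
      mesh F (\bigcap_(h in H) lpreim h A).

(* The family with the finite intersection property is indexed by the pairs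
   [(V, x)] with [V] in [F] and [x] in [W V]. *)
Definition piecewise_syndetic F A : Prop :=
  exists H W : set S -> set S,
    (forall V, F V -> nonempty_finite_subsets V (H V) /\ F (W V)) /\
    finI [set i : set S * S | F i.1 /\ W i.1 i.2]
      (fun i => lpreim i.2 (\bigcup_(h in H i.1) lpreim h A) `&` i.1).

End FilterSyndetic.

(* Main.v *)
Require Import Defs.
From mathcomp Require Import all_boot all_order all_algebra finmap.
From mathcomp Require Import all_classical.

(** Write [q'A] for [translates_in q A], the set of the [x] with [x^-1 A] in
    [q].  Then [A] is in [p q] if and only if [q'A] is in [p], and the filter
    [F q], made of the [A] with [q'A] in [F], has as its closure the left ideal
    [closure(F) q] of [closure(F)] ([filter_closure_mulP]).

    Any ultrafilter [q] containing the family with the finite intersection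
    property contains [F], and for each [V] in [F] a finite union of sets
    [h^-1 A] with [h] in [V] belongs to [F q] ([piecewise_syndetic_witness]).
    As [closure(F)] is a semigroup, so is [closure(F q)], and being compact it
    has an idempotent [e] ([ellis_numakura]).

    The idea is to compare [A] with [e'A].  Let [D] be the set of the points at
    which they agree.  As [e = e e], a translate [h^-1 A] is in [e] if and only
    if [h^-1 (e'A)] is, so [h^-1 D] is in [e] for every [h]: the set [D] is
    thick ([thick_agreement]), and so is [C = A `|` D].

    Put [B = A `|` ~` D], so that [A = B `&` C].  If [B] were not syndetic, then
    for some [V] in [F] and some [r] in [closure(F)] the complement of [h^-1 B]
    would be in [r] for all [h] in [V] ([not_syndeticP]).  Off [B] the sets [A]
    and [e'A] agree and [A] fails, so [h^-1 (e'A)] is not in [r], that is,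
    [h^-1 A] is not in [r e].  But [e = p q] with [p] in [closure(F)], so
    [r e = (r p) q] extends [F q] and contains a finite union of sets [h^-1 A]
    with [h] in [V], hence one of these sets: a contradiction. *)

Set Implicit Arguments.
Unset Strict Implicit.
Unset Printing Implicit Defensive.

Local Open Scope classical_set_scope.

(** * Ultrafilters *)

Section Ultrafilters.
Variable T : Type.
Implicit Types (F D p : set_system T) (A B : set T).

Lemma ultraC p A : UltraFilter p -> p (~` A) <-> ~ p A.
Proof.
move=> pU; split=> [pnA pA|npA]; last by have [] := in_ultra_setVsetC A pU.
by apply: (filter_not_empty p); rewrite -(setICr A); exact: filterI.
Qed.

Lemma ultra_bigcup (I : choiceType) p (H : set I) (f : I -> set T) :
  UltraFilter p -> finite_set H -> p (\bigcup_(i in H) f i) ->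
  exists2 i, H i & p (f i).
Proof.
move=> pU finH pH; apply: contrapT => noH.
suff : p (\bigcap_(i in H) ~` f i).
  by rewrite -setC_bigcup => /ultraC; apply.
have [K HK] := finite_fsetP.1 finH; rewrite HK in noH *.
by apply: filter_bigI => i iK; apply/ultraC => pfi; apply: noH; exists i.
Qed.

Lemma ultra_of_decides p :
  ProperFilter p -> (forall A, p A \/ p (~` A)) -> UltraFilter p.
Proof.
move=> pF dec; split=> // G GF pG; apply/seteqP; split=> // A GA.
have [//|/pG GnA] := dec A.
by case: (filter_not_empty G); rewrite -(setICr A); exact: filterI.
Qed.

(** Compactness of the space of ultrafilters: a closed set, given by [F], that
    meets every member of a filter base [D] of clopen sets contains a point of
    their intersection. *)
Lemma ultra_extending_meets F D : Filter F -> D setT -> setI_closed D ->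
  F `#` D -> exists p, [/\ UltraFilter p, F `<=` p & D `<=` p].
Proof.
move=> FF DT DI FD.
pose G := filter_from [set PQ : set T * set T | F PQ.1 /\ D PQ.2]
  (fun PQ => PQ.1 `&` PQ.2).
have GP : ProperFilter G.
  apply: filter_from_proper; last by move=> [P Q] /= [FP DQ]; exact: FD.
  apply: filter_from_filter.
    by exists (setT, setT); split=> //; exact: filterT.
  move=> [P Q] [P' Q'] /= [FP DQ] [FP' DQ'].
  exists (P `&` P', Q `&` Q') => /=; last by rewrite setIACA.
  by split; [exact: filterI|exact: DI].
have [p [pU Gp]] := ultraFilterLemma GP.
exists p; split=> // A HA; apply: Gp.
- by exists (A, setT) => //= x [].
- by exists (setT, A) => /= [|x []//]; split=> //; exact: filterT.
Qed.

End Ultrafilters.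

(** * Products of filters and ultrafilters *)

Section BetaMul.
Variable S : semigroupType.
Implicit Types (F G p q r e u : set_system S) (A B V : set S).

Definition translates_in q A : set S := [set x | q (lpreim x A)].

Lemma translates_inT q : Filter q -> translates_in q setT = setT.
Proof. by move=> qF; apply/seteqP; split=> x // _; exact: filterT. Qed.

Lemma translates_inI q A B : Filter q ->
  translates_in q (A `&` B) = translates_in q A `&` translates_in q B.
Proof.
move=> qF; apply/seteqP; split=> x /=.
  by move=> qAB; split; apply: filterS qAB => y [].
by move=> [qA qB]; exact: filterI.
Qed.

Lemma translates_inC q A : UltraFilter q ->
  translates_in q (~` A) = ~` translates_in q A.
Proof.
move=> qU; apply/seteqP.
by split=> x; [exact: (ultraC (lpreim x A) qU).1|exact: (ultraC _ qU).2].
Qed.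

Lemma translates_inS q A B : Filter q -> A `<=` B ->
  translates_in q A `<=` translates_in q B.
Proof. by move=> qF AB x; apply: filterS => y; exact: AB. Qed.

Lemma lpreimM (x y : S) A : lpreim (x * y)%g A = lpreim y (lpreim x A).
Proof. by apply/seteqP; split=> z; rewrite /lpreim /= mulgA. Qed.

Lemma lpreim_translates_in q (h : S) A :
  lpreim h (translates_in q A) = translates_in q (lpreim h A).
Proof.
by apply/seteqP; split=> x; rewrite /lpreim /translates_in /= lpreimM.
Qed.

Lemma beta_mulA p q r : beta_mul (beta_mul p q) r = beta_mul p (beta_mul q r).
Proof.
apply/funext => A; congr p; apply/funext => x; congr q.
exact: lpreim_translates_in.
Qed.

Lemma beta_mul_proper F q :
  ProperFilter F -> ProperFilter q -> ProperFilter (beta_mul F q).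
Proof.
move=> FF qF; split.
  move=> F0; apply: (filter_not_empty F).
  by apply: (filterS _ (F0 : F _)) => x; exact: filter_not_empty.
split=> [|A B FA FB|A B AB FA]; rewrite /beta_mul /= -/(translates_in q _).
- by rewrite translates_inT; exact: filterT.
- by rewrite translates_inI; exact: filterI.
- by apply: (filterS _ (FA : F (translates_in q A))); exact: translates_inS.
Qed.

Lemma beta_mul_ultra p q :
  UltraFilter p -> UltraFilter q -> UltraFilter (beta_mul p q).
Proof.
move=> pU qU; apply: ultra_of_decides; first exact: beta_mul_proper.
move=> A; rewrite /beta_mul /= -!/(translates_in q _) translates_inC //.
exact: in_ultra_setVsetC.
Qed.

Lemma ultra_eq p q : UltraFilter p -> UltraFilter q -> p `<=` q -> p = q.
Proof. by move=> pU qU pq; rewrite (max_filter _ pq). Qed.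

Lemma filter_closure_ultra F p : filter_closure F p -> UltraFilter p.
Proof. by case. Qed.

(** A filter is the intersection of the ultrafilters that extend it. *)
Lemma filter_closure_mem F A : Filter F ->
  (forall p, filter_closure F p -> p A) -> F A.
Proof.
move=> FF clA; apply: contrapT => nFA.
have [||P B FP [->|->]|p [pU Fp Dp]] :=
    @ultra_extending_meets _ F [set B | B = setT \/ B = ~` A] _.
- by left.
- move=> B B' [->|->] [->|->]; rewrite /= ?setTI ?setIT ?setIid.
  + by left.
  + by right.
  + by right.
  + by right.
- rewrite setIT; apply/set0P/eqP => P0; apply: nFA.
  by apply: filterS FP; rewrite P0.
- apply/set0P/eqP => PnA; apply: nFA.
  by apply: filterS FP; apply/subsets_disjoint; rewrite PnA.
- suff : p (~` A) by move/ultraC; apply; apply: clA.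
  by apply: Dp; right.
Qed.

(** The right translate by [q] of the closed set given by [F] is closed, being
    a continuous image of a compact set; hence it is all of the closure of
    [beta_mul F q]. *)
Lemma filter_closure_mulP F q u : ProperFilter F -> UltraFilter q ->
  filter_closure (beta_mul F q) u ->
  exists2 p, filter_closure F p & u = beta_mul p q.
Proof.
move=> FF qU Fqu; have uU := filter_closure_ultra Fqu.
have [||P _ FP [A uA <-]|p [pU Fp qup]] :=
  @ultra_extending_meets _ F [set translates_in q A | A in u] _.
- by exists setT; [exact: filterT|rewrite translates_inT].
- move=> _ _ [A uA <-] [B uB <-]; exists (A `&` B); first exact: filterI.
  by rewrite translates_inI.
- apply: contrapT => /nonemptyPn PA0.
  suff : u (~` A) by move/ultraC; apply.
  apply: Fqu.2; rewrite /beta_mul /= -/(translates_in q _) translates_inC.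
  by apply: filterS FP; apply/subsets_disjoint; rewrite setCK.
- exists p => //; apply: ultra_eq => [|A uA]; first exact: beta_mul_ultra.
  by apply: qup; exists A.
Qed.

Lemma filter_closure_beta_mul F p q : UltraFilter q ->
  filter_closure F p -> filter_closure (beta_mul F q) (beta_mul p q).
Proof.
by move=> qU [betap Fp]; split; [exact: beta_mul_ultra|move=> A /Fp].
Qed.

(** * Idempotents *)

(** [(p q) (p' q) = (p q p') q] lies again in the right translate by [q]. *)
Lemma beta_mul_subsemigroup F q : ProperFilter F ->
  beta_subsemigroup (filter_closure F) -> filter_closure F q ->
  beta_subsemigroup (filter_closure (beta_mul F q)).
Proof.
move=> FF [_ FM] Fq; have qU := filter_closure_ultra Fq.
split=> [u []//|u v].
move=> /filter_closure_mulP[p Fp ->] /filter_closure_mulP[p' Fp' ->].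
rewrite -beta_mulA; apply: filter_closure_beta_mul.
by apply: (FM) => //; exact: FM.
Qed.

(** Closed subsemigroups are handled through their filters, so minimality of
    the subsemigroup is maximality of the filter, and the intersection of a
    chain is the union of the filters. *)
Lemma maximal_subsemigroup_filter F : ProperFilter F ->
  beta_subsemigroup (filter_closure F) ->
  exists G, [/\ ProperFilter G, beta_subsemigroup (filter_closure G), F `<=` G &
    forall N, ProperFilter N -> beta_subsemigroup (filter_closure N) ->
      G `<=` N -> N `<=` G].
Proof.
move=> FF Fsub.
pose good G := ProperFilter G /\ beta_subsemigroup (filter_closure G).
(* Joining [F] to each candidate makes the empty chain harmless. *)
have [|M [[MF Msub] Mmax]] := @Zorn_bigcup _ [set X | good (F `|` X)].
- move=> Xs Xsgood Xstot; set U := \bigcup_(X in Xs) X.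
  have common A B : (F `|` U) A -> (F `|` U) B -> exists X,
      [/\ good (F `|` X), F `|` X `<=` F `|` U, (F `|` X) A & (F `|` X) B].
    have XU X : Xs X -> F `|` X `<=` F `|` U.
      by move=> XsX; apply: setUS; exact: bigcup_sup.
    move=> [FA|[X XsX XA]] [FB|[Y XsY YB]].
    + by exists set0; rewrite setU0; split=> // C; left.
    + by exists Y; split; [exact: Xsgood|exact: XU|left|right].
    + by exists X; split; [exact: Xsgood|exact: XU|right|left].
    + have [XY|YX] := Xstot _ _ XsX XsY.
      * by exists Y; split; [exact: Xsgood|exact: XU|right; exact: XY|right].
      * by exists X; split; [exact: Xsgood|exact: XU|right|right; exact: YX].
  split; first split.
  + by move=> U0; have [X [[XF _] _ /filter_not_empty]] := common _ _ U0 U0.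
  + split=> [|A B UA UB|A B AB UA].
    * by left; exact: filterT.
    * have [X [[XF _] XU XA XB]] := common _ _ UA UB.
      by apply: XU; exact: filterI.
    * have [X [[XF _] XU XA _]] := common _ _ UA UA.
      by apply: XU; exact: filterS AB XA.
  + split=> [p []//|p q [pU Up] [qU Uq]]; split; first exact: beta_mul_ultra.
    move=> A UA; have [X [[_ [_ XM]] XU XA _]] := common _ _ UA UA.
    apply: (XM p q _ _).2 => //; split=> // B /XU; [exact: Up|exact: Uq].
- exists (F `|` M); split=> //.
  move=> N NF Nsub MN A NA; apply: contrapT => nMA.
  apply: (Mmax N).
    split=> [B MB|NM]; first by apply: MN; right.
    by apply: nMA; right; exact: NM.
  by rewrite /= setUidr // => B FB; apply: MN; left.
Qed.

(** For [e] in a minimal closed subsemigroup [K], both [K e] and the set of the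
    [p] in [K] with [p e = e] are closed subsemigroups, hence equal to [K]. *)
Theorem ellis_numakura F : ProperFilter F ->
  beta_subsemigroup (filter_closure F) ->
  exists2 e, filter_closure F e & beta_mul e e = e.
Proof.
move=> FF Fsub.
have [G [GF Gsub FG Gmax]] := maximal_subsemigroup_filter FF Fsub.
have [e [eU Ge]] := ultraFilterLemma GF.
have Gcle : filter_closure G e by [].
exists e; first by split=> //; exact: subset_trans Ge.
(* By minimality the right translate by [e] is onto, so [e] has the form
   [p e]. *)
have GeG : beta_mul G e `<=` G.
  apply: Gmax; [exact: beta_mul_proper|exact: beta_mul_subsemigroup|].
  move=> A GA; apply: (@filter_closure_mem G (translates_in e A)) => p Gp.
  by have [_] := Gsub.2 _ _ Gp Gcle; apply.
have [|p0 Gp0 p0e] := @filter_closure_mulP G e e _ _ _.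
  by split=> //; exact: subset_trans GeG Ge.
(* The filter of the closed subsemigroup of all [p] with [p e = e]. *)
pose N := [set X | forall p, filter_closure G p -> beta_mul p e = e -> p X].
have GN : G `<=` N by move=> X GX p [_ Gp] _; exact: Gp.
have NF : ProperFilter N.
  split.
    have p0U := filter_closure_ultra Gp0.
    by move=> /(_ p0 Gp0 (esym p0e)); exact: filter_not_empty.
  split=> [p Gp _|A B NA NB p Gp pe|A B AB NA p Gp pe];
    have pU := filter_closure_ultra Gp.
  - exact: filterT.
  - by apply: filterI; [exact: NA|exact: NB].
  - by apply: filterS AB _; exact: NA.
have Nclosure p : filter_closure N p -> filter_closure G p /\ beta_mul p e = e.
  move=> [pU Np]; split; first by split=> //; exact: subset_trans Np.
  apply/esym/ultra_eq => [|A eA]; first exact: beta_mul_ultra.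
  by apply: Np => r _ re; have : beta_mul r e A by rewrite re.
apply: (Nclosure e _).2; split=> //; apply: subset_trans Ge; apply: Gmax => //.
split=> [p []//|p q /Nclosure[Gp pe] /Nclosure[Gq qe]].
have Gpq := Gsub.2 _ _ Gp Gq.
by split; [exact: Gpq.1|move=> X; apply=> //; rewrite beta_mulA qe].
Qed.

(** * Syndetic and thick sets *)

(** Extend the family with the finite intersection property to an ultrafilter
    [q].  Its members indexed by the pairs [(V, x)] force [V] into [q] and, for
    fixed [V], put [W V] inside [translates_in q] of the union over [H V]. *)
Lemma piecewise_syndetic_witness F A : ProperFilter F ->
  piecewise_syndetic F A ->
  exists2 q, filter_closure F q & forall V, F V ->
    exists2 H, nonempty_finite_subsets V H &
      beta_mul F q (\bigcup_(h in H) lpreim h A).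
Proof.
move=> FF [H [W [HW /[dup] fip /finI_filter /ultraFilterLemma[q [qU sub_q]]]]].
have {}sub_q V x : F V -> W V x ->
    q (lpreim x (\bigcup_(h in H V) lpreim h A) `&` V).
  move=> FV Wx; apply: sub_q; eexists; last exact: subset_refl.
  exact: (finI_from1 _ (_ : [set i | F i.1 /\ W i.1 i.2] (V, x))).
exists q.
  split=> // V FV; have [x Wx] := filter_ex (HW V FV).2.
  by apply: filterS (sub_q _ _ FV Wx) => y [].
move=> V FV; exists (H V); first exact: (HW V FV).1.
by apply: filterS (HW V FV).2 => x /(sub_q _ _ FV); apply: filterS => y [].
Qed.

(** Thickness holds with [V] the whole semigroup: as [e = e e], either both of
    [lpreim h A] and [translates_in e (lpreim h A)] are in [e], or both of their
    complements are, and the two sets agree on the intersection either way. *)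
Lemma thick_agreement F e A : filter_closure F e -> beta_mul e e = e ->
  Filter F -> thick F [set x | A x <-> translates_in e A x].
Proof.
move=> Fe ee FF; have eU := filter_closure_ultra Fe.
exists setT => [|H [finH _ _]]; first exact: filterT.
move=> /Fe.2/ultraC; apply.
have [K ->] := finite_fsetP.1 finH; apply: filter_bigI => h _.
have eeE B : e (translates_in e B) <-> e B by rewrite -[in X in _ <-> X]ee.
have [ehA|nehA] := pselect (e (lpreim h A)).
  apply: filterS (filterI ehA ((eeE _).2 ehA)) => x [Ahx].
  by rewrite -lpreim_translates_in.
have nee : ~ e (translates_in e (lpreim h A)) by rewrite eeE.
apply: filterS (filterI ((ultraC _ eU).2 nehA) ((ultraC _ eU).2 nee)).
by move=> x [nAhx]; rewrite -lpreim_translates_in; split.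
Qed.

Lemma thickS F A B : Filter F -> A `<=` B -> thick F A -> thick F B.
Proof.
move=> FF AB [V FV thV]; exists V => // H /thV nF FnB; apply: nF.
apply: filterS FnB; apply: subsetC => x hA h Hh.
by apply: AB; exact: hA.
Qed.

(** The failure of syndeticity is witnessed by a single ultrafilter. *)
Lemma not_syndeticP F B : ProperFilter F -> ~ syndetic F B ->
  exists V r, [/\ F V, filter_closure F r &
    forall h, V h -> r (~` lpreim h B)].
Proof.
move=> FF /existsNP[V /not_implyP[FV noH]].
have [h0 Vh0] := filter_ex FV.
pose D := [set \bigcap_(h in H) ~` lpreim h B
            | H in [set H | finite_set H /\ H `<=` V]].
have [||P _ FP [H [finH HV] <-]|r [rU Fr Dr]] :=
    @ultra_extending_meets _ F D _.
- exists set0; last exact: bigcap_set0.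
  by split; [exact: finite_set0|exact: sub0set].
- move=> _ _ [H [finH HV] <-] [K [finK KV] <-]; exists (H `|` K).
    by split; [rewrite finite_setU|rewrite subUset].
  exact: bigcap_setU.
- apply: contrapT => /nonemptyPn PH0; apply: noH.
  (* [H] may be empty; adding [h0] is harmless. *)
  exists (h0 |` H).
    split; first by rewrite finite_setU.
      by exists h0; left.
    by move=> h [->|/HV].
  apply: filterS FP => x Px; apply: contrapT => nx.
  suff : set0 x by [].
  by rewrite -PH0; split=> // h Hh hB; apply: nx; exists h => //; right.
- exists V, r; split=> // h Vh; apply: Dr; exists [set h].
    by split=> // _ ->.
  by rewrite bigcap_set1.
Qed.

End BetaMul.

Theorem theorem4p10 (S : semigroupType) (F : set_system S)
    (F_filter : ProperFilter F)
    (F_subsemigroup : beta_subsemigroup (filter_closure F))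
    (A : set S) (A_pws : piecewise_syndetic F A) :
  exists B C : set S, [/\ syndetic F B, thick F C & A = B `&` C].
Proof.
have [q Fq Aq] := piecewise_syndetic_witness F_filter A_pws.
have qU := filter_closure_ultra Fq.
have Fq_subsemigroup := beta_mul_subsemigroup F_filter F_subsemigroup Fq.
have [e Fqe ee] :=
  ellis_numakura (beta_mul_proper F_filter _) Fq_subsemigroup.
have [p Fp epq] := filter_closure_mulP F_filter qU Fqe.
have eU := filter_closure_ultra Fqe.
have Fe : filter_closure F e by rewrite epq; exact: F_subsemigroup.2.
pose D := [set x | A x <-> translates_in e A x].
exists (A `|` ~` D), (A `|` D); split; last by rewrite -setUIr setICl setU0.
  2: by apply: thickS (thick_agreement A Fe ee _) => x Dx; right.
apply: contrapT => /not_syndeticP[V [r [FV Fr rV]]].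
have rU := filter_closure_ultra Fr.
have re_Fq : filter_closure (beta_mul F q) (beta_mul r e).
  rewrite epq -beta_mulA; apply: filter_closure_beta_mul.
  exact: F_subsemigroup.2.
have reU := filter_closure_ultra re_Fq.
have [H [finH _ HV] FqH] := Aq _ FV.
have [h Hh rehA] := ultra_bigcup reU finH (re_Fq.2 _ FqH).
suff : r (~` translates_in e (lpreim h A)) by move/ultraC; apply.
apply: filterS (rV _ (HV _ Hh)) => x nB.
rewrite -lpreim_translates_in => ehA; apply: nB.
have [Ax|nAx] := pselect (A (h * x)%g); first by left.
by right=> -[_ /(_ ehA)].
Qed.
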